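(* Let $\mathcal F$ be a Swapping ACF with $b$ slots per bin, false positive rate parameter $\epsilon$, and $N=\Theta(n)$ slots. Then there exists an adversarial strategy, making $\Theta(b/\epsilon^{b})$ queries, which wins the adaptivity game against $\mathcal F$ with probability $\Omega(1)$.
   Context: Asymptotics are as $n\to\infty$. Swapping ACF (adaptive cuckoo filter). The filter stores a set $S=\{x_1,\ldots,x_n\}$ from a large universe $U$ ($|U|\gg n$). There are $k$ hash tables (numbered $0,\ldots,k-1$), each with $M$ bins, where each bin has $b>1$ slots (numbered $0,\ldots,b-1$) and each slot holds one $f$-bit fingerprint or is empty. The filter uses independent uniformly random hash functions: location hashes $h^\ell_0,\ldots,h^\ell_{k-1}:U\to\{0,\ldots,M-1\}$ and a fingerprint hash $h^f:U\times\{0,\ldots,b-1\}\to\{0,\ldots,2^f-1\}$. The parameter $f$ is set to $\log_2(n/(M\epsilon))$ to obtain false positive rate $\epsilon$. Each $x_i\in S$ is stored in some slot $\sigma_i$ of bin $h^\ell_{\beta_i}(x_i)$ of table $\beta_i$, for some $\beta_i\in\{0,\ldots,k-1\}$ found by cuckoo-hashing insertion; that slot contains $h^f(x_i,\sigma_i)$. Distinct elements occupy distinct slots. Query: on query $q$ the filter answers ''present'' if for some table $\beta$ and some slot $\sigma$ of bin $h^\ell_\beta(q)$ of table $\beta$, the slot is occupied and stores $h^f(q,\sigma)$; otherwise ''absent''. A query $q\notin S$ answered ''present'' is a false positive; the stored element in the matching slot is said to collide with $q$. Fixing: after a false positive $q$ colliding with $x_i$ stored in slot $\sigma_i$, the filter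 picks $\sigma'\in\{0,\ldots,b-1\}\setminus\{\sigma_i\}$ uniformly at random and swaps the contents of slots $\sigma_i$ and $\sigma'$ of the bin storing $x_i$: $x_i$ is now stored in slot $\sigma'$ with fingerprint $h^f(x_i,\sigma')$, and the element $x_j$ previously in slot $\sigma'$ (if any) is now stored in slot $\sigma_i$ with fingerprint $h^f(x_j,\sigma_i)$. Adaptivity game: an adversary generates a sequence of queries. After each query $q$, both the adversary and the filter learn whether $q$ was a false positive; the filter may change its internal representation in response, and the adversary may use this information to choose later queries. At any time the adversary may name a special element $\hat q$; the adversary wins if $\hat q$ is a false positive at that time, and the filter wins otherwise.
   Formalization: The universe is assumed to satisfy |U| ≥ D(n + b/ε^b), not only |U| ≫ n (with ε = 2^-n, |U| = n² the claim fails); k and b are fixed, so the Ω(1) constant may depend on k, b and the constants in N = Θ(n), and probability is conditional on successful insertion. *)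

(* Defs.v *)
From HB Require Import structures.
From mathcomp Require Import all_boot all_order all_algebra all_fingroup.
From mathcomp Require Import reals exp.
Import Order.TTheory GRing.Theory Num.Theory.

Set Implicit Arguments.
Unset Strict Implicit.
Unset Printing Implicit Defensive.

Local Open Scope ring_scope.

Definition log2 (R : realType) (x : R) : R := ln x / ln 2.

Definition expectation (R : realType) (T : finType) (X : T -> R) : R :=
  (\sum_(t : T) X t) / #|T|%:R.

Definition slot (k M b : nat) : finType := ('I_k * 'I_M * 'I_b)%type.

Definition table_of k M b (s : slot k M b) : 'I_k := s.1.1.
Definition bin_of k M b (s : slot k M b) : 'I_M := s.1.2.
Definition index_of k M b (s : slot k M b) : 'I_b := s.2.

(* Which stored element, named by its number i < n, occupies each slot. The
   fingerprints held by the filter are computed from it, see [fingerprint_in]. *)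
Definition contents (n k M b : nat) : finType :=
  {ffun slot k M b -> option 'I_n}.

(* The uniform distribution on this finite type makes all the hash values of the
   location hashes (first component) and of the fingerprint hash (second
   component) independent and uniform. *)
Definition hashes (U : finType) (k M b f : nat) : finType :=
  ({ffun 'I_k * U -> 'I_M} * {ffun U * 'I_b -> 'I_(2 ^ f)})%type.

Definition hloc U k M b f (h : hashes U k M b f) (beta : 'I_k) (u : U) : 'I_M :=
  h.1 (beta, u).
Definition hfp U k M b f (h : hashes U k M b f) (u : U) (sigma : 'I_b) :
  'I_(2 ^ f) := h.2 (u, sigma).

Definition valid_contents n k M b (loc : {ffun 'I_n * 'I_k -> 'I_M})
    (C : contents n k M b) : Prop :=
  (forall s i, C s = Some i -> bin_of s = loc (i, table_of s)) /\
  (forall i, #|[set s | C s == Some i]| = 1%N).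

(* [insert] is an arbitrary, possibly randomized, insertion procedure: [seed]
   carries its uniform random coins, and [None] means that it failed. It only
   sees the hash values of the stored elements.
   [tie] selects which collision gets fixed when the query matches several
   slots (for instance the first one in a scanning order). *)
Record swapping_acf (U : finType) (n k M b f : nat) := SwappingACF {
  elt : 'I_n -> U;
  elt_inj : injective elt;
  seed : finType;
  insert : seed -> {ffun 'I_n * 'I_k -> 'I_M} ->
    {ffun 'I_n * 'I_b -> 'I_(2 ^ f)} -> option (contents n k M b);
  insert_valid : forall w loc fp C,
    insert w loc fp = Some C -> valid_contents loc C;
  tie : {set slot k M b} -> slot k M b;
  tie_in : forall A, A != set0 -> tie A \in A
}.

(* A deterministic adversary is a decision tree: it names its special element,
   or makes a query and goes on according to whether that query was a false
   positive (the boolean). *)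
Inductive strategy (U : Type) : Type :=
| Name of U
| Query of U & (bool -> strategy U).

Fixpoint min_queries (U : Type) (t : strategy U) : nat :=
  match t with
  | Name _ => 0
  | Query _ next => (minn (min_queries (next true)) (min_queries (next false))).+1
  end.

Fixpoint max_queries (U : Type) (t : strategy U) : nat :=
  match t with
  | Name _ => 0
  | Query _ next => (maxn (max_queries (next true)) (max_queries (next false))).+1
  end.

Record adversary (U : Type) := Adversary {
  coins : finType;
  play : coins -> strategy U
}.

Section Game.
Variables (R : realType) (U : finType) (n k M b f : nat).
Variable F : swapping_acf U n k M b f.
Variable h : hashes U k M b f.

Definition initial_contents (w : seed F) : option (contents n k M b) :=
  insert w [ffun p => hloc h p.2 (elt F p.1)] [ffun p => hfp h (elt F p.1) p.2].

Definition fingerprint_in (C : contents n k M b) (s : slot k M b) :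
    option 'I_(2 ^ f) :=
  omap (fun i => hfp h (elt F i) (index_of s)) (C s).

Definition matching_slots (C : contents n k M b) (q : U) : {set slot k M b} :=
  [set s | (bin_of s == hloc h (table_of s) q) &&
           (fingerprint_in C s == Some (hfp h q (index_of s)))].

Definition present (C : contents n k M b) (q : U) : bool :=
  matching_slots C q != set0.

Definition false_positive (C : contents n k M b) (q : U) : bool :=
  (q \notin codom (elt F)) && present C q.

Definition swap (C : contents n k M b) (s s' : slot k M b) : contents n k M b :=
  [ffun t => C (tperm s s' t)].

(* Probability, over the coins of the fixing steps, that the adversary
   following [t] wins from contents C, the hash functions being fixed. *)
Fixpoint win_from (t : strategy U) (C : contents n k M b) : R :=
  match t with
  | Name q => (false_positive C q)%:R
  | Query q next =>
      if false_positive C q then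
        let s := tie F (matching_slots C q) in
        (\sum_(sigma' : 'I_b | sigma' != index_of s)
            win_from (next true) (swap C s (table_of s, bin_of s, sigma')))
          / (b.-1)%:R
      else win_from (next false) C
  end.

End Game.

Definition stored_probability (R : realType) U n k M b f
    (F : swapping_acf U n k M b f) : R :=
  expectation (fun h : hashes U k M b f =>
    expectation (fun w : seed F => (isSome (initial_contents h w))%:R)).

(* Conditional on the insertion having succeeded. *)
Definition win_probability (R : realType) U n k M b f
    (F : swapping_acf U n k M b f) (A : adversary U) : R :=
  expectation (fun h : hashes U k M b f =>
    expectation (fun w : seed F =>
      expectation (fun a : coins A =>
        if initial_contents h w is Some C then win_from R F h (play a) C
        else 0)))
  / stored_probability R F.

(* Main.v *)
(* The attack queries a random element as long as it is a false positive and
   moves on to a fresh random element as soon as it is not; when the budget is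
   spent it names the current element.  Swaps never move a stored element out of
   its bin, so a query that agrees with some stored element on all b
   fingerprints, in the bin of that element, is a false positive forever.  A
   random query has this property with probability of order eps^b.

   A query that can still miss does so within a bounded expected time: the
   arrangement of the bins it reads is one of at most (b!)^k states, so some miss
   is reachable in boundedly many steps, each of probability 1/(b-1).  A query
   that cannot miss any more wins.  Hence, with the hash functions fixed, the
   attack wins with probability at least linear in the budget times the fraction
   of persistent queries, up to a constant cap.  A second moment bound on the
   number of persistent queries, over the hash values of the elements that are
   not stored, concludes; as the contents and the hash values of the stored
   elements are arbitrary there, conditioning on a successful insertion is
   harmless. *)

Require Import Defs.
From mathcomp Require Import all_boot all_order all_algebra all_fingroup.
From mathcomp Require Import all_classical all_reals.
From mathcomp Require Import exp.
From mathcomp Require Import ring lra.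
Import Order.TTheory GRing.Theory Num.Theory.

Set Implicit Arguments.
Unset Strict Implicit.
Unset Printing Implicit Defensive.

Local Open Scope ring_scope.

(** * Uniform expectations over finite types *)

Section Expectation.
Variable R : realType.
Implicit Types T : finType.

Lemma eq_expectation T (X Y : T -> R) :
  X =1 Y -> expectation X = expectation Y.
Proof. by move=> XY; congr (_ / _); apply: eq_bigr. Qed.

Lemma expectation_le T (X Y : T -> R) :
  (forall t, X t <= Y t) -> expectation X <= expectation Y.
Proof.
by move=> XY; rewrite ler_wpM2r ?invr_ge0 ?ler0n //; apply: ler_sum.
Qed.

Lemma expectation_ge0 T (X : T -> R) :
  (forall t, 0 <= X t) -> 0 <= expectation X.
Proof. by move=> X0; rewrite divr_ge0 ?ler0n ?sumr_ge0. Qed.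

Lemma expectation_cst T (t : T) (a : R) : expectation (fun _ : T => a) = a.
Proof.
rewrite /expectation sumr_const -[a *+ _]mulr_natr mulfK //.
by rewrite pnatr_eq0 -lt0n; apply/card_gt0P; exists t.
Qed.

Lemma expectationD T (X Y : T -> R) :
  expectation (fun t => X t + Y t) = expectation X + expectation Y.
Proof. by rewrite /expectation big_split mulrDl. Qed.

Lemma expectationZ T (a : R) (X : T -> R) :
  expectation (fun t => a * X t) = a * expectation X.
Proof. by rewrite /expectation -mulr_sumr mulrA. Qed.

Lemma expectation_sum T (I : finType) (P : pred I) (X : I -> T -> R) :
  expectation (fun t => \sum_(i | P i) X i t)
  = \sum_(i | P i) expectation (X i).
Proof. by rewrite /expectation exchange_big /= mulr_suml. Qed.

Lemma expectation_swap T1 T2 (X : T1 -> T2 -> R) :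
  expectation (fun s => expectation (fun t => X s t)) =
  expectation (fun t => expectation (fun s => X s t)).
Proof.
by rewrite /expectation -!mulr_suml exchange_big /= -!mulrA [_^-1 * _]mulrC.
Qed.

Lemma expectation_pair T1 T2 (X : T1 * T2 -> R) :
  expectation X = expectation (fun s => expectation (fun t => X (s, t))).
Proof.
rewrite /expectation -mulr_suml card_prod natrM invfM -mulrA [_^-1 * _]mulrC.
by rewrite pair_bigA; congr (_ * _); apply: eq_bigr => -[].
Qed.

Lemma expectation_bij T1 T2 (g : T1 -> T2) (X : T2 -> R) :
  bijective g -> expectation (fun t => X (g t)) = expectation X.
Proof.
move=> bij_g; rewrite /expectation (bij_eq_card bij_g); congr (_ / _).
by rewrite [RHS](reindex g) //; exact: onW_bij.
Qed.

Lemma expectation_tuple T m (X : m.+1.-tuple T -> R) :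
  expectation X =
  expectation (fun u => expectation (fun s : m.-tuple T => X [tuple of u :: s])).
Proof.
rewrite -(expectation_pair (fun p : T * m.-tuple T => X [tuple of p.1 :: p.2])).
rewrite -(@expectation_bij _ _ (fun p : T * m.-tuple T => [tuple of p.1 :: p.2])) //.
exists (fun s => (thead s, [tuple of behead s])) => [[u s]|s] /=.
  by congr pair; apply/val_inj.
by rewrite -tuple_eta.
Qed.

Lemma expectation_tuple0 T (X : 0.-tuple T -> R) : expectation X = X [tuple].
Proof.
by rewrite -[RHS](expectation_cst ([tuple] : 0.-tuple T)); apply: eq_expectation => s;
  rewrite tuple0.
Qed.

End Expectation.

(** * The attack as a decision tree *)

(** A hit discards the next draw instead of saving it. Every branch therefore makes exactly as many
    queries as there are draws, and a draw in use is independent of the past. *)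
Fixpoint attack (U : Type) (q : U) (draws : seq U) : strategy U :=
  if draws is u :: draws' then
    Query q (fun fp => attack (if fp then q else u) draws')
  else Name q.

Lemma min_queries_attack (U : Type) (q : U) draws :
  min_queries (attack q draws) = size draws.
Proof. by elim: draws q => //= u s IHs q; rewrite !IHs minnn. Qed.

Lemma max_queries_attack (U : Type) (q : U) draws :
  max_queries (attack q draws) = size draws.
Proof. by elim: draws q => //= u s IHs q; rewrite !IHs maxnn. Qed.

(* The expected time to a miss that is d steps away is at most K_d where K_0 = 1,
   K_{d+1} = 1 + K_d / (b-1) + (1 - 1/(b-1)) K_L and L bounds the distances;
   hitting_slack b j is K_L - K_{L-j}. *)
Fixpoint hitting_slack (b j : nat) : nat :=
  if j is j'.+1 then ((hitting_slack b j').+1 * b.-1)%N else 0%N.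

Lemma hitting_slack_homo b : (1 < b)%N ->
  {homo hitting_slack b : i j / (i <= j)%N}.
Proof.
move=> b_gt1; apply: homo_leq => [//|i j m|j /=]; first exact: leq_trans.
by rewrite (leq_trans (leqnSn _)) // leq_pmulr // -subn1 subn_gt0.
Qed.

(** * Persistent queries and reachability of a miss, for fixed hash functions *)

Section FixedHashes.
Variables (U : finType) (n k M b f : nat).
Variable F : swapping_acf U n k M b f.
Variable h : hashes U k M b f.

Local Notation cont := (contents n k M b).

Definition fixed_slot (C : cont) (q : U) := tie F (matching_slots F h C q).

Definition fix_with (C : cont) (q : U) (sigma : 'I_b) : cont :=
  let s := fixed_slot C q in swap C s (table_of s, bin_of s, sigma).

Lemma fixed_slotP (C : cont) (q : U) : false_positive F h C q ->
  fixed_slot C q \in matching_slots F h C q.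
Proof. by case/andP=> _; apply: tie_in. Qed.

Definition persistent (C : cont) (q : U) : bool :=
  (q \notin codom (elt F)) &&
  [exists s, exists i, [&& C s == Some i, bin_of s == hloc h (table_of s) q &
    [forall sigma, hfp h (elt F i) sigma == hfp h q sigma]]].

Lemma persistent_false_positive C q :
  persistent C q -> false_positive F h C q.
Proof.
case/andP=> qS /existsP[s /existsP[i /and3P[/eqP Cs bs /forallP fs]]].
apply/andP; split=> //; apply/set0Pn; exists s; rewrite inE bs /=.
by rewrite /fingerprint_in Cs /= (eqP (fs _)).
Qed.

Lemma persistent_fix_with C q r sigma :
  persistent C r -> persistent (fix_with C q sigma) r.
Proof.
rewrite /persistent.
case/andP=> -> /existsP[s /existsP[i /and3P[Cs bs fs]]] /=.
(* The occupant of [s] ends up in slot [tperm s0 s1 s]; this is in the bin of [s], since [s0] and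
   [s1] share their table and bin. *)
rewrite /fix_with; set s0 := fixed_slot C q; set s1 := (_, sigma).
apply/existsP; exists (tperm s0 s1 s); apply/existsP; exists i.
rewrite fs ffunE tpermK Cs andbT /=.
by case: tpermP bs => // ->.
Qed.

(** The depth counts the missing query too: depth 1 means a miss right now, and depth 0 is
    impossible. *)
Fixpoint can_miss (q : U) (d : nat) (C : cont) : bool :=
  if d is d'.+1 then
    ~~ false_positive F h C q ||
    [exists (sigma | sigma != index_of (fixed_slot C q)),
       can_miss q d' (fix_with C q sigma)]
  else false.

(** Fixing [q] only permutes slots inside the [k] bins that [q] reads. One permutation per table
    thus parametrises all contents met while [q] is repeated, whatever [n] and [M] are. *)
Definition arrange (C : cont) (q : U) (g : {ffun 'I_k -> 'S_b}) : cont :=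
  [ffun t => if bin_of t == hloc h (table_of t) q then
    C (table_of t, bin_of t, g (table_of t) (index_of t)) else C t].

Lemma arrange1 C q : arrange C q [ffun=> 1%g] = C.
Proof.
apply/ffunP => -[[beta m] i]; rewrite !ffunE; case: ifP => // _.
by rewrite perm1.
Qed.

Definition rearrange (C : cont) (q : U) (g : {ffun 'I_k -> 'S_b})
    (sigma : 'I_b) : {ffun 'I_k -> 'S_b} :=
  let s := fixed_slot (arrange C q g) q in
  [ffun beta => if beta == table_of s
                then (tperm (index_of s) sigma * g beta)%g else g beta].

Lemma fix_with_arrange C q g sigma : false_positive F h (arrange C q g) q ->
  fix_with (arrange C q g) q sigma = arrange C q (rearrange C q g sigma).
Proof.
move=> /fixed_slotP; rewrite inE => /andP[/eqP + _].
rewrite /fix_with /rearrange; set s := fixed_slot _ _.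
case: s => -[beta m] i; rewrite /table_of /bin_of /index_of /= => m_eq.
apply/ffunP => -[[beta' m'] i']; rewrite !ffunE /=.
rewrite /table_of /bin_of /index_of /=.
have [->|ne] := eqVneq beta' beta; last first.
  by rewrite tpermD //; apply: contra_neq ne => -[].
have [->|ne] := eqVneq m' m; last first.
  rewrite -m_eq (negPf ne) tpermD; [|by apply: contra_neq ne => -[]..].
  by rewrite /= -m_eq (negPf ne).
have inj_slot : injective (fun j : 'I_b => (beta, m, j)) by move=> j j' [].
by rewrite -(inj_tperm i sigma i' inj_slot) /= m_eq eqxx permM.
Qed.

Definition miss_step (C : cont) (q : U) (X : {set {ffun 'I_k -> 'S_b}}) :=
  [set g | ~~ false_positive F h (arrange C q g) q ||
    [exists (sigma |
               sigma != index_of (fixed_slot (arrange C q g) q)),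
       rearrange C q g sigma \in X]].

Lemma miss_step_homo C q : {homo miss_step C q : X Y / X \subset Y}.
Proof.
move=> X Y /fintype.subsetP XY; apply/fintype.subsetP => g; rewrite !inE.
case: (~~ _) => //= /existsP[sigma /andP[ne gX]].
by apply/existsP; exists sigma; rewrite ne XY.
Qed.

Lemma can_miss_arrange C q d g :
  can_miss q d (arrange C q g) = (g \in iter d (miss_step C q) finset.set0).
Proof.
elim: d g => [|d IHd] g; rewrite ?inE //=.
case: (boolP (false_positive _ _ _ _)) => //= fp.
by apply: eq_existsb => sigma; rewrite fix_with_arrange // IHd.
Qed.

(** The arrangements from which a miss is within depth [d] form the [d]-th iterate, from the empty
    set, of a monotone operator on a finite power set. All iterates lie in the one whose index is
    the number of arrangements. *)
Lemma can_miss_bound C q d :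
  can_miss q d C -> can_miss q #|{ffun 'I_k -> 'S_b}| C.
Proof.
rewrite -[C](arrange1 _ q) !can_miss_arrange; apply/fintype.subsetP.
exact: (iter_sub_fix (miss_step_homo C q)).
Qed.

End FixedHashes.

(** * Winning probability of the attack, for fixed hash functions *)

Section AttackValue.
Variables (R : realType) (U : finType) (n k M b f : nat).
Variable F : swapping_acf U n k M b f.
Variable h : hashes U k M b f.
Hypothesis b_gt1 : (1 < b)%N.

Local Notation cont := (contents n k M b).

Definition attack_value (T : nat) (q : U) (C : cont) : R :=
  expectation (fun s : T.-tuple U => win_from R F h (attack q s) C).

Definition fresh_value (T : nat) (C : cont) : R :=
  expectation (fun u => attack_value T u C).

Lemma attack_value0 q C : attack_value 0 q C = (false_positive F h C q)%:R.
Proof. by rewrite /attack_value expectation_tuple0. Qed.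

Lemma attack_valueS_miss T q C : (0 < #|U|)%N -> ~~ false_positive F h C q ->
  attack_value T.+1 q C = fresh_value T C.
Proof.
move=> U_gt0 /negPf miss; rewrite /attack_value expectation_tuple.
by apply: eq_expectation => u; apply: eq_expectation => s /=; rewrite miss.
Qed.

Lemma attack_valueS_hit T q C : false_positive F h C q ->
  attack_value T.+1 q C =
  (\sum_(sigma | sigma != index_of (fixed_slot F h C q))
     attack_value T q (fix_with F h C q sigma)) / b.-1%:R.
Proof.
move=> hit; rewrite /attack_value expectation_tuple.
(* The discarded draw is averaged out; [q] only witnesses that [U] is inhabited. *)
rewrite -[RHS](expectation_cst q); apply: eq_expectation => u.
rewrite -expectation_sum mulrC -expectationZ; apply: eq_expectation => s.
by rewrite /= hit mulrC.
Qed.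

Lemma card_other_slots (i : 'I_b) : #|[pred j | j != i]| = b.-1.
Proof. by rewrite cardC1 card_ord. Qed.

Lemma predb_gt0 : 0 < b.-1%:R :> R.
Proof. by rewrite ltr0n -ltnS (ltn_predK b_gt1). Qed.

Lemma le_average (i : 'I_b) (X : 'I_b -> R) (a : R) :
  (forall j, j != i -> a <= X j) ->
  a <= (\sum_(j | j != i) X j) / b.-1%:R.
Proof.
move=> aX; rewrite ler_pdivlMr ?predb_gt0 //.
rewrite -{1}(card_other_slots i) mulr_natr -sumr_const.
by apply: ler_sum => j; apply: aX.
Qed.

Lemma le_average_slack (i j : 'I_b) (X : 'I_b -> R) (a d : R) :
  j != i -> (forall j, j != i -> a <= X j) -> a + d * b.-1%:R <= X j ->
  a + d <= (\sum_(j | j != i) X j) / b.-1%:R.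
Proof.
move=> ji aX adX; rewrite ler_pdivlMr ?predb_gt0 // mulrDl -{1}(card_other_slots i) mulr_natr -sumr_const.
rewrite (bigD1 j) //= [leRHS](bigD1 j) //= addrAC lerD //.
by apply: ler_sum => l /andP[]; move=> /aX.
Qed.

(** Under an invariant that forces hits, no fresh element replaces [q], so [q] is the element named
    at the end and is still a false positive. *)
Lemma attack_value_always (P : pred cont) T q C :
  (forall C, P C -> false_positive F h C q) ->
  (forall C sigma, P C -> sigma != index_of (fixed_slot F h C q) ->
     P (fix_with F h C q sigma)) ->
  P C -> 1 <= attack_value T q C.
Proof.
move=> P_fp P_fix; elim: T C => [|T IHT] C PC.
  by rewrite attack_value0 P_fp.
rewrite attack_valueS_hit ?P_fp //; apply: le_average => sigma ne.
by apply: IHT; apply: P_fix.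
Qed.

Lemma persistent_attack_value T q C :
  persistent F h C q -> 1 <= attack_value T q C.
Proof.
apply: (attack_value_always (P := fun C => persistent F h C q)) =>
  [C'|C' sigma per _]; first exact: persistent_false_positive.
exact: persistent_fix_with.
Qed.

(* All arrangements, up to swaps, of the k bins that a query reads. *)
Local Notation L := #|{ffun 'I_k -> 'S_b}|.

(** Being unable to miss within depth [L] is itself an invariant: a miss found after one more swap
    has depth at most [L + 1], hence at most [L] by saturation. *)
Lemma never_miss_attack_value T q C :
  ~~ can_miss F h q L C -> 1 <= attack_value T q C.
Proof.
apply: (attack_value_always (P := fun C => ~~ can_miss F h q L C)) => [C'|C' sigma].
  apply: contraR => miss; apply: (@can_miss_bound _ _ _ _ _ _ _ _ _ _ 1).
  by rewrite /= miss.
move=> + ne; apply: contra => miss.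
apply: (@can_miss_bound _ _ _ _ _ _ _ _ _ _ L.+1) => /=.
by apply/orP; right; apply/existsP; exists sigma; rewrite ne.
Qed.

(** This is [K_L], since [hitting_slack b L] is [K_L - K_0] and [K_0 = 1]. *)
Definition attack_cost : nat := (hitting_slack b L).+1.

Section Induction.
Variables (alpha rho : R) (B : nat).
Hypotheses (alpha_ge0 : 0 <= alpha) (alphaB : 2 * (alpha * B%:R) <= 1).
Hypothesis alpha_rho : 2 * alpha * attack_cost%:R <= rho.

Let enough (C : cont) := rho * #|U|%:R <= #|[pred q | persistent F h C q]|%:R.

Lemma enough_fix_with C q sigma : enough C -> enough (fix_with F h C q sigma).
Proof.
move=> /le_trans; apply; rewrite ler_nat; apply: subset_leq_card.
by apply/fintype.subsetP => r; rewrite !inE; apply: persistent_fix_with.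
Qed.

Let K : R := attack_cost%:R.

(** A fresh draw is persistent with probability at least [rho] and then wins; otherwise it is worth
    at least [a]. As [a] is at most 1/2, the gain [(1 - a) * rho] is at least [rho / 2], which pays
    for the loss [alpha * K]. *)
Lemma fresh_value_step T C : (0 < #|U|)%N -> (T <= B)%N -> enough C ->
  (forall q, alpha * (T%:R - K) <= attack_value T q C) ->
  alpha * T%:R <= fresh_value T C.
Proof.
move=> U_gt0 TB enC le_attack; set a := alpha * (T%:R - K) in le_attack *.
have aT : 2 * (alpha * T%:R) <= 1.
  have : alpha * T%:R <= alpha * B%:R by rewrite ler_wpM2l // ler_nat.
  by have := alphaB; lra.
have aK : 0 <= alpha * K by rewrite mulr_ge0 ?ler0n.
have a_le : a + (1 - a) * rho <= fresh_value T C.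
  have le_u u : a + (1 - a) * (persistent F h C u)%:R <= attack_value T u C.
    case: (boolP (persistent F h C u)) => [per|_].
      by rewrite mulr1 addrC subrK persistent_attack_value.
    by rewrite mulr0 addr0.
  apply: le_trans (expectation_le le_u).
  have [u _] := card_gt0P U_gt0.
  rewrite expectationD (expectation_cst u) lerD2l expectationZ.
  apply: ler_wpM2l.
    by rewrite /a; lra.
  rewrite /expectation ler_pdivlMr ?ltr0n // (le_trans enC) //.
  by rewrite -natr_sum -sum1_card big_mkcond.
apply: le_trans a_le; have le_rho : 2 * (alpha * K) <= rho by rewrite mulrA.
(* The first factor is [2 * (1 - a) - 1]. *)
have : 0 <= (1 - 2 * (alpha * T%:R) + 2 * (alpha * K)) * rho.
  by apply: mulr_ge0; lra.
by rewrite /a; lra.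
Qed.

(** The slack grows as the miss gets nearer. On a hit, one of the [b - 1] equally likely swaps moves
    a step towards the miss; its extra slack, divided by [b - 1], pays for the query and restores
    the current slack. The other swaps fall back on the slackless bound. *)
Lemma attack_value_ge T j q C : (0 < #|U|)%N -> (T <= B)%N -> enough C ->
  (j <= L)%N -> can_miss F h q (L - j) C ->
  alpha * (T%:R - K + (hitting_slack b j)%:R) <= attack_value T q C.
Proof.
elim: T j q C => [|T IHT] j q C U_gt0 TB enC jL.
  move=> _; apply: (@le_trans _ _ 0); last by rewrite attack_value0.
  rewrite sub0r mulr_ge0_le0 // addrC subr_le0 ler_nat.
  by rewrite ltnW // ltnS hitting_slack_homo.
have IH q' C' : enough C' -> alpha * (T%:R - K) <= attack_value T q' C'.
  move=> enC'; case: (boolP (can_miss F h q' L C')) => [miss|nmiss].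
    by have := IHT 0%N q' C' U_gt0 (ltnW TB) enC' isT; rewrite subn0 addr0; apply.
  apply: le_trans (never_miss_attack_value T nmiss).
  have : alpha * T%:R <= alpha * B%:R by rewrite ler_wpM2l // ler_nat ltnW.
  have : 0 <= alpha * K by rewrite mulr_ge0 ?ler0n.
  by have := alphaB; lra.
case: (boolP (false_positive F h C q)) => [fp|nfp]; last first.
  move=> _; rewrite attack_valueS_miss //.
  apply: le_trans (fresh_value_step U_gt0 (ltnW TB) enC _); last first.
    by move=> q'; apply: IH.
  (* The missing query costs one unit of budget, which fits because the slack is at most [K - 1]. *)
  rewrite ler_wpM2l //.
  have : ((hitting_slack b j).+1%:R <= K) by rewrite ler_nat ltnS hitting_slack_homo.
  by rewrite -!natr1; lra.
case E : (L - j)%N => [//|d] /=; rewrite fp /= => /existsP[sigma /andP[ne miss]].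
rewrite attack_valueS_hit //.
have -> : alpha * (T.+1%:R - K + (hitting_slack b j)%:R) =
  alpha * (T%:R - K) + alpha * (hitting_slack b j).+1%:R.
  by rewrite -!natr1; ring.
apply: (le_average_slack ne) => [sigma' _|].
  by apply: IH; apply: enough_fix_with.
(* By its recursion, [hitting_slack b j.+1] is [(hitting_slack b j).+1 * b.-1]. *)
rewrite -mulrA -natrM -mulrDr.
have jL' : (j < L)%N by rewrite -subn_gt0 E.
apply: (IHT j.+1) => //; [exact: ltnW | exact: enough_fix_with |].
by rewrite subnS E.
Qed.

Lemma fresh_value_ge C : (0 < #|U|)%N -> enough C ->
  alpha * B%:R <= fresh_value B C.
Proof.
move=> U_gt0 enC; apply: fresh_value_step => // q.
case: (boolP (can_miss F h q L C)) => [miss|nmiss].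
  have := @attack_value_ge B 0 q C U_gt0 (leqnn _) enC isT.
  by rewrite subn0 addr0; apply.
apply: le_trans (never_miss_attack_value B nmiss).
have : 0 <= alpha * K by rewrite mulr_ge0 ?ler0n.
by have := alphaB; lra.
Qed.

End Induction.

(* The bound min (z, K') >= z - z^2 / (4 K') turns the guarantee into a
   polynomial in the number of persistent queries, ready for a second moment
   argument. *)
Lemma fresh_value_quadratic (K' : R) B C X : (0 < #|U|)%N ->
  attack_cost%:R <= K' ->
  (X <= #|[pred q | persistent F h C q]|)%N ->
  forall z, z = X%:R / #|U|%:R * B%:R ->
  (2 * K')^-1 * (z - z ^+ 2 / (4 * K')) <= fresh_value B C.
Proof.
move=> U_gt0 KK' leX z zE.
have K_gt0 : 0 < K'.
  by apply: lt_le_trans KK'; rewrite ltr0n.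
have U0 : 0 < #|U|%:R :> R by rewrite ltr0n.
pose rho : R := X%:R / #|U|%:R.
have rho_ge0 : 0 <= rho by rewrite divr_ge0.
have enC : rho * #|U|%:R <= #|[pred q | persistent F h C q]|%:R.
  by rewrite divfK ?gt_eqF // ler_nat.
rewrite -/rho in zE.
have [zK|Kz] := leP z K'.
  (* Here [rho] limits the rate: this is the largest [alpha] allowed with [K'] as cost, and
     [z <= K'] keeps [alpha * B] below 1/2. *)
  have := @fresh_value_ge (rho / (2 * K')) rho B _ _ _ C U_gt0 enC.
  have -> : rho / (2 * K') * B%:R = z / (2 * K') by rewrite zE mulrAC.
  move=> le_z; apply: le_trans (le_z _ _ _).
  - rewrite [leRHS]mulrC; apply: ler_wpM2l; first by rewrite invr_ge0; lra.
    by rewrite gerBl divr_ge0 ?sqr_ge0 //; lra.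
  - by rewrite divr_ge0 //; lra.
  - rewrite mulrA ler_pdivrMr ?mulr_gt0 // mul1r.
    by rewrite ler_pM2l.
  have -> : 2 * (rho / (2 * K')) = rho / K' by field; rewrite gt_eqF.
  rewrite mulrAC ler_pdivrMr //.
  by rewrite ler_wpM2l.
have B_gt0 : 0 < B%:R :> R.
  rewrite lt0r ler0n andbT; apply: contraTneq Kz => B0.
  by rewrite zE B0 mulr0 -leNgt ltW.
(* Here the cap binds: this [alpha] guarantees 1/2, which the quadratic never exceeds, by completing
   the square. *)
have := @fresh_value_ge ((2 * B%:R)^-1) rho B _ _ _ C U_gt0 enC.
rewrite invfM divfK ?gt_eqF // => le_half; apply: le_trans (le_half _ _ _).
- have -> : (2 * K')^-1 * (z - z ^+ 2 / (4 * K')) =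
    2^-1 - (z - 2 * K') ^+ 2 / (8 * K' ^+ 2).
    by field; rewrite gt_eqF.
  by rewrite gerBl divr_ge0 ?sqr_ge0 // mulr_ge0 ?sqr_ge0.
- by rewrite mulr_ge0 ?invr_ge0.
- by lra.
rewrite mulrA mulfV ?pnatr_eq0 // mul1r mulrC ler_pdivrMr // -zE.
exact: le_trans KK' (ltW Kz).
Qed.

End AttackValue.

(** * Marginals of uniform distributions by resampling *)

Section Resampling.
Variable R : realType.

(** The map from [(t, v)] to [(put t v, get t)] is an involution, so it preserves the uniform law
    and exchanges [get t] with an independent uniform [v]. *)
Lemma expectation_lens (T V : finType) (get : T -> V) (put : T -> V -> T)
    (X : V -> R) (t0 : T) :
  (forall t v, get (put t v) = v) -> (forall t v, put (put t v) (get t) = t) ->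
  expectation (fun t => X (get t)) = expectation X.
Proof.
move=> getK putK.
pose g (p : T * V) := (put p.1 p.2, get p.1).
have gK : involutive g by move=> [t v]; rewrite /g /= putK getK.
transitivity (expectation (fun p : T * V => X (get p.1))).
  rewrite expectation_pair; apply: eq_expectation => t /=.
  by rewrite (expectation_cst (get t)).
rewrite -(expectation_bij _ (inv_bij gK)) expectation_pair.
rewrite -[RHS](expectation_cst t0); apply: eq_expectation => t.
by apply: eq_expectation => v; rewrite /g /= getK.
Qed.

Lemma expectation_restrict (T J V : finType) (j : J -> T) (g0 : {ffun T -> V})
    (X : {ffun J -> V} -> R) : injective j ->
  expectation (fun g : {ffun T -> V} => X [ffun i => g (j i)]) = expectation X.
Proof.
move=> inj_j.
pose put (g : {ffun T -> V}) (v : {ffun J -> V}) :=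
  [ffun t => if [pick i | j i == t] is Some i then v i else g t].
have pick_j (A : Type) (G : J -> A) a i :
    (if [pick i' | j i' == j i] is Some i' then G i' else a) = G i.
  by case: pickP => [i' /eqP/inj_j -> //|/(_ i)]; rewrite eqxx.
rewrite (expectation_lens (put := put)) //.
- by move=> g v; apply/ffunP => i; rewrite !ffunE pick_j.
- move=> g v; apply/ffunP => t; rewrite !ffunE.
  by case: pickP => [i /eqP <-|//]; rewrite ffunE.
Qed.

Lemma expectation_eq (T : finType) (t0 : T) :
  expectation (fun t => (t == t0)%:R) = #|T|%:R^-1 :> R.
Proof.
rewrite /expectation -natr_sum (bigD1 t0) //= eqxx big1 ?addn0 ?mul1r // => t.
by move/negPf->.
Qed.

End Resampling.

(** * First and second moments of the number of matching elements *)

Section HashProbability.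
Variables (R : realType) (U : finType) (k M b f : nat).
Local Notation H := (hashes U k M b f).

Definition splice (A : pred U) (x y : H) : H :=
  ([ffun p => if A p.2 then x.1 p else y.1 p],
   [ffun p => if A p.1 then x.2 p else y.2 p]).

Lemma spliceK A x y : splice A (splice A x y) (splice A y x) = x.
Proof.
case: x => x1 x2; congr pair; apply/ffunP => p; rewrite !ffunE /=.
  by case: (A p.2).
by case: (A p.1).
Qed.

(** Two independent samples may exchange their values outside [A]: this is an involution on
    pairs. *)
Lemma expectation_splice A (X : H -> R) :
  expectation (fun x => expectation (fun y => X (splice A x y))) = expectation X.
Proof.
pose g (p : H * H) := (splice A p.1 p.2, splice A p.2 p.1).
have gK : involutive g by move=> [x y]; rewrite /g /= !spliceK.
rewrite -(expectation_pair (fun p => X (g p).1)).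
rewrite (expectation_bij (fun p => X p.1) (inv_bij gK)) expectation_pair.
by apply: eq_expectation => x /=; rewrite (expectation_cst x).
Qed.

Variable target : 'I_M -> option {ffun 'I_b -> 'I_(2 ^ f)}.
Variable beta : 'I_k.

(** With a single table and at most one vector per bin, the events for different bins are disjoint,
    so the probability is exact. *)
Definition on_target (y : H) (q : U) : bool :=
  if target (hloc y beta q) is Some v then
    [ffun sigma => hfp y q sigma] == v
  else false.

Lemma on_target_splice A x y q :
  on_target (splice A x y) q = if A q then on_target x q else on_target y q.
Proof.
rewrite /on_target /hloc ffunE /=.
have -> : [ffun sigma => hfp (splice A x y) q sigma] =
    if A q then [ffun sigma => hfp x q sigma] else [ffun sigma => hfp y q sigma].
  by apply/ffunP => sigma; rewrite ffunE /hfp ffunE /=; case: (A q); rewrite ffunE.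
by case: (A q).
Qed.

Definition target_probability : R :=
  #|[pred m | target m]|%:R / M%:R / (2%:R ^+ f) ^+ b.

Lemma expectation_on_target (y0 : H) q :
  expectation (fun y => (on_target y q)%:R) = target_probability.
Proof.
rewrite expectation_pair.
transitivity (expectation (fun y1 : {ffun 'I_k * U -> 'I_M} =>
    (target (y1 (beta, q)))%:R / (2%:R ^+ f) ^+ b : R)).
  apply: eq_expectation => y1; rewrite /on_target /hloc /hfp /=.
  case: target => [v|] /=; last first.
    by rewrite mul0r (expectation_cst y0.2).
  rewrite (expectation_restrict y0.2 (j := fun sigma => (q, sigma))
    (fun v' => (v' == v)%:R)).
    by rewrite expectation_eq card_ffun !card_ord mul1r !natrX.
  by move=> sigma sigma' [].
pose put (y1 : {ffun 'I_k * U -> 'I_M}) m :=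
  [ffun p => if p == (beta, q) then m else y1 p].
rewrite (expectation_lens (put := put)
  (fun m => (target m)%:R / (2%:R ^+ f) ^+ b) y0.1).
- rewrite /expectation -mulr_suml -natr_sum card_ord /target_probability.
  by rewrite mulrAC; congr (_%:R / _ / _); rewrite -sum1_card [RHS]big_mkcond.
- by move=> y1 m; rewrite ffunE eqxx.
- by move=> y1 m; apply/ffunP => p; rewrite !ffunE; case: eqP => [->|].
Qed.

(** Distinct elements read disjoint hash values, so resampling those of [q] alone decouples the two
    events. *)
Lemma expectation_on_target2 (y0 : H) q q' : q != q' ->
  expectation (fun y => (on_target y q)%:R * (on_target y q')%:R)
  = target_probability ^+ 2.
Proof.
move=> qq'; rewrite -(expectation_splice (pred1 q)).
rewrite -(expectation_on_target y0 q) [RHS]expr2 [in RHS]mulrC -expectationZ.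
apply: eq_expectation => x; rewrite (expectation_on_target y0 q).
rewrite -(expectation_on_target y0 q') mulrC -expectationZ.
apply: eq_expectation => y.
by rewrite !on_target_splice /= eqxx eq_sym (negPf qq').
Qed.

Variable S : pred U.

Definition hits (y : H) : nat := #|[pred q | ~~ S q && on_target y q]|.

Lemma hitsE y : (hits y)%:R = \sum_(q | ~~ S q) (on_target y q)%:R :> R.
Proof.
rewrite -natr_sum /hits -sum1_card -big_mkcondr.
by congr _%:R; apply: eq_bigl => q; rewrite inE.
Qed.

Lemma target_probability_ge0 : 0 <= target_probability.
Proof. by rewrite !divr_ge0 // !exprn_ge0. Qed.

Lemma expectation_hits (y0 : H) :
  expectation (fun y => (hits y)%:R) = #|predC S|%:R * target_probability.
Proof.
under eq_expectation do rewrite hitsE.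
rewrite expectation_sum; under eq_bigr do rewrite expectation_on_target //.
by rewrite sumr_const mulr_natl.
Qed.

(** Diagonal pairs contribute [p] each, and the others [p ^+ 2] by pairwise independence. *)
Lemma expectation_hits2 (y0 : H) :
  expectation (fun y => (hits y)%:R ^+ 2) <=
  #|U|%:R * target_probability + (#|U|%:R * target_probability) ^+ 2.
Proof.
set p := target_probability.
have p_ge0 : 0 <= p := target_probability_ge0.
have le_q q : expectation (fun y => \sum_(q' | ~~ S q')
    (on_target y q)%:R * (on_target y q')%:R) <= p + #|U|%:R * p ^+ 2.
  rewrite expectation_sum.
  apply: (@le_trans _ _ (\sum_q' ((if q' == q then p else 0) + p ^+ 2))).
    rewrite [leLHS]big_mkcond; apply: ler_sum => q' _; case: ifP => _.
      have [->|qq'] := eqVneq q' q.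
        rewrite -[leLHS]addr0 lerD ?sqr_ge0 //.
        rewrite /p -(expectation_on_target y0 q); apply: expectation_le => y.
        by case: on_target; rewrite ?mulr1 ?mul0r.
      by rewrite add0r expectation_on_target2 // eq_sym.
    by rewrite addr_ge0 ?sqr_ge0 //; case: ifP.
  by rewrite big_split /= -big_mkcond big_pred1_eq sumr_const mulr_natl.
under eq_expectation do rewrite hitsE expr2 mulr_suml.
under eq_expectation do under eq_bigr do rewrite mulr_sumr.
rewrite expectation_sum.
apply: (@le_trans _ _ (\sum_(q : U) (p + #|U|%:R * p ^+ 2))).
  rewrite big_mkcond; apply: ler_sum => q _; case: ifP => // _.
  by rewrite addr_ge0 // mulr_ge0 // sqr_ge0.
rewrite sumr_const -[_ *+ _]mulr_natl; set u : R := #|U|%:R.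
by have -> : u * (p + u * p ^+ 2) = u * p + (u * p) ^+ 2 by ring.
Qed.

End HashProbability.

(** * A table with many occupied bins *)

Section Occupancy.
Variables (n k M b : nat).

Definition occupant (C : contents n k M b) (beta : 'I_k) (m : 'I_M) :
    option 'I_n :=
  [pick i | [exists s, [&& C s == Some i, table_of s == beta & bin_of s == m]]].

(** The elements fill [n] distinct slots of occupied bins, with [b] slots per bin; the table with
    most occupied bins reaches the average over the [k] tables. *)
Lemma popular_table (loc : {ffun 'I_n * 'I_k -> 'I_M}) (C : contents n k M b) :
  (0 < k)%N -> valid_contents loc C ->
  exists beta, (n <= k * #|[pred m | occupant C beta m]| * b)%N.
Proof.
move=> k_gt0 [_ C_stored]; pose occ beta := #|[pred m | occupant C beta m]|.
have k_gt0' : (0 < #|'I_k|)%N by rewrite card_ord.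
have [beta max_beta] := bigop.eq_bigmax occ k_gt0'.
exists beta; rewrite -/(occ beta) -max_beta.
have slot_of i : {s | C s == Some i}.
  apply: sigW; have /card_gt0P[s] : (0 < #|finset (fun s => C s == Some i)|)%N.
    by rewrite C_stored.
  by rewrite inE; exists s.
pose g i := sval (slot_of i).
have gP i : C (g i) = Some i := eqP (svalP (slot_of i)).
have inj_g : injective g by move=> i j gij; apply: Some_inj; rewrite -!gP gij.
rewrite -[leqLHS](card_ord n) -(card_codom inj_g).
apply: (@leq_trans #|[pred s : slot k M b | occupant C (table_of s) (bin_of s)]|).
  apply/subset_leq_card/fintype.subsetP => s /codomP[i ->]; rewrite inE /occupant.
  case: pickP => // /(_ i) /existsP; case.
  by exists (g i); rewrite gP !eqxx.
rewrite -sum1_card big_mkcond /=.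
rewrite -(pair_bigA _ (fun (p : 'I_k * 'I_M) (sigma : 'I_b) =>
   if occupant C p.1 p.2 then 1%N else 0%N)) /=.
under eq_bigr do rewrite sum_nat_const card_ord mulnC.
rewrite -big_distrl /= leq_mul2r; apply/orP; right.
rewrite -(pair_bigA _ (fun beta m => if occupant C beta m then 1%N else 0%N)) /=.
apply: (@leq_trans (\sum_(beta' : 'I_k) \max_beta'' occ beta'')).
  by apply: leq_sum => beta' _; rewrite -big_mkcond sum1_card leq_bigmax.
by rewrite sum_nat_const card_ord.
Qed.

End Occupancy.

(** * Averaging over the hash values of the elements that are not stored *)

Section AverageCase.
Variables (R : realType) (U : finType) (n k M b f : nat).
Variable F : swapping_acf U n k M b f.
Hypothesis b_gt1 : (1 < b)%N.
Variables (x : hashes U k M b f) (C : contents n k M b) (beta : 'I_k).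

Local Notation stored := [pred q | q \in codom (elt F)].

(** The vectors depend on [x] and [C] only, so they stay fixed while [y] varies. *)
Definition clone_target (m : 'I_M) : option {ffun 'I_b -> 'I_(2 ^ f)} :=
  omap (fun i => [ffun sigma => hfp x (elt F i) sigma]) (occupant C beta m).

Lemma hits_persistent y :
  (hits clone_target beta stored y <=
   #|[pred q | persistent F (splice stored x y) C q]|)%N.
Proof.
apply/subset_leq_card/fintype.subsetP => q; rewrite !inE => /andP[qS].
rewrite /on_target /clone_target /occupant; case: pickP => [i|//] /=.
case/existsP=> s /and3P[Cs /eqP ts bs] /eqP/ffunP fpq.
rewrite /persistent qS; apply/existsP; exists s; apply/existsP; exists i.
rewrite Cs ts /hloc ffunE /= (negPf qS) bs /=.
apply/forallP => sigma; have := fpq sigma.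
by rewrite !ffunE /hfp !ffunE /= (negPf qS) codom_f => ->.
Qed.

(** In the quadratic bound, the linear term averages to at least [m / 2], because at least half of
    [U] is not stored. The square averages to at most [m + m ^+ 2], hence at most [m * K], so the
    correction is at most [m / 4]. *)
Lemma expectation_fresh_value_ge (B : nat) (K : R) :
  let p := target_probability R clone_target in
  (attack_cost k b)%:R + 1 + B%:R * p <= K ->
  (0 < #|U|)%N -> (2 * n <= #|U|)%N -> (B <= #|U|)%N ->
  B%:R * p / (8 * K) <=
  expectation (fun y => fresh_value R F (splice stored x y) B C).
Proof.
move=> p le_K U_gt0 nU BU.
have p_ge0 : 0 <= p := target_probability_ge0 R clone_target.
set m := B%:R * p in le_K *.
have m_ge0 : 0 <= m by rewrite mulr_ge0.
have K_ge1 : 1 + m <= K.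
  by apply: le_trans le_K; rewrite -addrA lerDr.
have K_gt0 : 0 < K by lra.
have u_gt0 : 0 < #|U|%:R :> R by rewrite ltr0n.
pose z y : R := (hits clone_target beta stored y)%:R / #|U|%:R * B%:R.
have le_z y : (2 * K)^-1 * (z y - z y ^+ 2 / (4 * K)) <=
    fresh_value R F (splice stored x y) B C.
  apply: (fresh_value_quadratic _ _ _ (hits_persistent y)) => //.
  by apply: le_trans le_K; rewrite -addrA lerDl addr_ge0.
apply: le_trans (expectation_le le_z).
rewrite expectationZ.
pose t : R := B%:R / #|U|%:R.
have zE y : z y - z y ^+ 2 / (4 * K) =
    t * (hits clone_target beta stored y)%:R +
    (- (t ^+ 2 / (4 * K))) * (hits clone_target beta stored y)%:R ^+ 2.
  by rewrite /z /t; field; rewrite !gt_eqF.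
rewrite (eq_expectation zE) expectationD !expectationZ expectation_hits //.
have := expectation_hits2 R clone_target beta stored x.
rewrite -/p; set E2 := expectation _ => le_E2.
have tm : t * (#|U|%:R * p) = m by rewrite /t /m; field; rewrite gt_eqF.
have le_first : m / 2 <= t * (#|predC stored|%:R * p).
  suff le_half : #|U|%:R / 2 <= #|predC stored|%:R :> R.
    rewrite -tm -mulrA; apply: ler_wpM2l; first by rewrite divr_ge0.
    by rewrite mulrAC; apply: ler_wpM2r.
  have := cardC stored; rewrite card_codom; last exact: elt_inj.
  rewrite card_ord => cardU.
  have : (2 * n)%:R <= #|U|%:R :> R by rewrite ler_nat.
  by rewrite -cardU natrM !natrD; lra.
have le_second : t ^+ 2 * E2 <= m + m ^+ 2.
  apply: (@le_trans _ _ (t ^+ 2 * (#|U|%:R * p + (#|U|%:R * p) ^+ 2))).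
    by apply: ler_wpM2l => //; exact: sqr_ge0.
  have -> : t ^+ 2 * (#|U|%:R * p + (#|U|%:R * p) ^+ 2) =
    t * (t * (#|U|%:R * p)) + (t * (#|U|%:R * p)) ^+ 2 by ring.
  (* The budget is at most the size of [U], so [t <= 1]. *)
  rewrite tm lerD2r ler_piMl // /t ler_pdivrMr // mul1r ler_nat //.
have m2 : m + m ^+ 2 <= m * K by have := ler_wpM2l m_ge0 K_ge1; lra.
have le_ratio : t ^+ 2 / (4 * K) * E2 <= m / 4.
  rewrite mulrAC ler_pdivrMr ?mulr_gt0 //.
  by apply: le_trans le_second _; apply: le_trans m2 _; lra.
have -> : m / (8 * K) = (2 * K)^-1 * (m / 4) by field; rewrite gt_eqF.
apply: ler_wpM2l; first by rewrite invr_ge0; lra.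
by rewrite mulNr; lra.
Qed.

End AverageCase.

(** * Conditioning on a successful insertion *)

Section WinProbability.
Variables (R : realType) (U : finType) (n k M b f : nat).
Variable F : swapping_acf U n k M b f.

Local Notation stored := [pred q | q \in codom (elt F)].

Definition attacker (B : nat) : adversary U :=
  @Adversary U (U * B.-tuple U)%type (fun a => attack a.1 a.2).

Lemma initial_contents_splice x y w :
  initial_contents (F := F) (splice stored x y) w = initial_contents x w.
Proof.
by rewrite /initial_contents; congr (insert _ _ _); apply/ffunP => p;
  rewrite !ffunE /= ?/hloc ?/hfp !ffunE /= codom_f.
Qed.

(** Insertion sees only the values taken from [x]. For each [x] and [w] where it succeeds, averaging
    over [y] gives at least [c]; summing gives [c] times the success probability, which the
    conditioning divides out. *)
Lemma win_probability_ge (c : R) (B : nat) :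
  (forall x w C, initial_contents (F := F) x w = Some C ->
     c <= expectation (fun y => fresh_value R F (splice stored x y) B C)) ->
  0 < stored_probability R F -> (0 < #|U|)%N ->
  c <= win_probability R F (attacker B).
Proof.
move=> le_c succ_gt0 U_gt0; rewrite /win_probability ler_pdivlMr //.
have [u _] := card_gt0P U_gt0.
pose phi h w : R :=
  if initial_contents (F := F) h w is Some C then fresh_value R F h B C else 0.
have phiE h w : expectation (fun a : coins (attacker B) =>
    if initial_contents h w is Some C then win_from R F h (play a) C else 0) =
  phi h w.
  rewrite /phi expectation_pair; case: initial_contents => [C|].
    by [].
  rewrite -[RHS](expectation_cst (u, [tuple of nseq B u])) expectation_pair.
  exact: eq_expectation.
under eq_expectation do under eq_expectation do rewrite phiE.
rewrite -(expectation_splice stored) -expectationZ.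
apply: expectation_le => x; rewrite expectation_swap -expectationZ.
apply: expectation_le => w; rewrite /phi.
under eq_expectation do rewrite initial_contents_splice.
case E : initial_contents => [C|] /=.
  by rewrite mulr1; apply: le_c E.
by rewrite mulr0 expectation_ge0.
Qed.

End WinProbability.

(** * Numerical estimates and the final choice of constants *)

Lemma pow2_log2 (R : realType) (f : nat) (x : R) :
  0 < x -> f%:R = log2 x -> 2 ^+ f = x :> R.
Proof.
move=> x_gt0 fE; apply: ln_inj; rewrite ?posrE ?exprn_gt0 //.
have ln2_gt0 : 0 < ln (2 : R) by apply: ln_gt0; lra.
by rewrite lnXn // -[ln 2 *+ f]mulr_natl fE divfK ?gt_eqF.
Qed.

Lemma attack_length (R : realType) (x : R) : 1 <= x ->
  exists B : nat, x <= B%:R <= 2 * x.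
Proof.
move=> x_ge1; exists (Num.truncn x).+1.
have /andP[le_x lt_x] : (Num.truncn x)%:R <= x < (Num.truncn x).+1%:R.
  by apply: truncn_itv; lra.
by rewrite ltW //= -natr1; lra.
Qed.

(** With [r = M / n], all fingerprints agree with probability [(eps * r) ^+ b], so a budget of order
    [b / eps ^+ b] cancels the power of [eps]. The slot count confines [r], and the share of
    occupied bins lies between [1 / u] and 1. *)
Lemma hit_rate_bounds (R : realType) (n k M b f B N : nat) (l u eps : R) :
  (0 < n)%N -> (0 < k)%N -> (0 < M)%N -> (0 < b)%N -> 0 < l -> 0 < u ->
  0 < eps -> 2 ^+ f = n%:R / (M%:R * eps) ->
  l * n%:R <= (k * M * b)%:R <= u * n%:R ->
  b%:R / eps ^+ b <= B%:R <= 2 * (b%:R / eps ^+ b) ->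
  (N <= M)%N -> (n <= k * N * b)%N ->
  b%:R * (l / (k * b)%:R) ^+ b / u <= B%:R * (N%:R / M%:R / (2 ^+ f) ^+ b)
    <= 2 * b%:R * (u / (k * b)%:R) ^+ b.
Proof.
rewrite -!(ltr0n R) => n0 k0 M0 b0 l0 u0 eps0 fE /andP[le_l le_u] /andP[le_B ge_B] NM nN.
have kb0 : 0 < (k * b)%:R :> R by rewrite natrM mulr_gt0.
pose r : R := M%:R / n%:R.
have r_ge0 : 0 <= r by rewrite divr_ge0.
have kMb : (k * M * b)%:R = (k * b)%:R * M%:R :> R by rewrite mulnAC natrM.
have r_ge : l / (k * b)%:R <= r.
  by rewrite ler_pdivrMr // mulrAC ler_pdivlMr // [leRHS]mulrC -kMb.
have r_le : r <= u / (k * b)%:R.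
  by rewrite ler_pdivlMr // mulrAC ler_pdivrMr // mulrC -kMb.
have ratio_ge : u^-1 <= N%:R / M%:R.
  rewrite ler_pdivlMr // mulrC ler_pdivrMr // -(ler_pM2l kb0) -kMb.
  apply: le_trans le_u _; rewrite mulrA mulrC ler_pM2r //.
  by rewrite -natrM mulnAC ler_nat.
have ratio_le : N%:R / M%:R <= 1 :> R.
  by rewrite ler_pdivrMr // mul1r ler_nat.
have powE : (2 ^+ f) ^+ b = (eps ^+ b * r ^+ b)^-1.
  rewrite fE -exprMn -exprVn; congr (_ ^+ b); rewrite /r.
  by field; rewrite !gt_eqF.
have epsb0 : 0 < eps ^+ b by rewrite exprn_gt0.
have rateE : B%:R * (N%:R / M%:R / (2 ^+ f) ^+ b) =
    B%:R * eps ^+ b * r ^+ b * (N%:R / M%:R).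
  by rewrite powE invrK; ring.
have le_Beps : b%:R <= B%:R * eps ^+ b by rewrite -ler_pdivrMr.
have ge_Beps : B%:R * eps ^+ b <= 2 * b%:R.
  by rewrite -ler_pdivlMr // -mulrA.
have l_ge0 : 0 <= l / (k * b)%:R by rewrite divr_ge0 // ltW.
have u_ge0 : 0 <= u / (k * b)%:R by rewrite divr_ge0 // ltW.
have pow_ge : (l / (k * b)%:R) ^+ b <= r ^+ b by rewrite lerXn2r.
have pow_le : r ^+ b <= (u / (k * b)%:R) ^+ b by rewrite lerXn2r.
rewrite rateE -[X in _ <= _ <= X]mulr1.
by apply/andP; split; do 2?[apply: ler_pM => //];
  rewrite ?mulr_ge0 ?exprn_ge0 ?invr_ge0 ?ler0n ?(ltW l0) ?(ltW u0) ?(ltW eps0).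
Qed.

Local Open Scope classical_set_scope.

Theorem theorem10 (R : realType) :
  exists C1 C2 : R, 0 < C1 /\ 0 < C2 /\
  forall (k b : nat) (l u : R), (0 < k)%N -> (1 < b)%N -> 0 < l -> 0 < u ->
  exists c D : R, 0 < c /\ 0 < D /\
  \forall n \near \oo, forall (M f : nat) (eps : R) (U : finType),
    0 < eps < 1 ->
    f%:R = log2 (n%:R / (M%:R * eps)) ->
    l * n%:R <= (k * M * b)%:R <= u * n%:R ->
    D * (n%:R + b%:R / eps ^+ b) <= #|U|%:R ->
    exists A : adversary U,
      (forall a : coins A,
         C1 * (b%:R / eps ^+ b) <= (min_queries (play a))%:R /\
         (max_queries (play a))%:R <= C2 * (b%:R / eps ^+ b)) /\
      forall F : swapping_acf U n k M b f,
        0 < stored_probability R F -> c <= win_probability R F A.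
Proof.
exists 1, 2; split=> //; split=> // k b l u k0 b1 l0 u0.
have b0 : (0 < b)%N := ltnW b1.
have kb0 : 0 < (k * b)%:R :> R by rewrite ltr0n muln_gt0 k0.
pose m0 : R := b%:R * (l / (k * b)%:R) ^+ b / u.
(* [m0] and [m1] bound the budget times the target probability from below and above, uniformly in
   [n], [M], [f] and [eps]. *)
pose m1 : R := 2 * b%:R * (u / (k * b)%:R) ^+ b.
have m0_gt0 : 0 < m0.
  by rewrite divr_gt0 // mulr_gt0 ?ltr0n // exprn_gt0 // divr_gt0.
have m1_ge0 : 0 <= m1.
  by rewrite mulr_ge0 ?mulr_ge0 // exprn_ge0 // divr_ge0 // ltW.
pose K : R := (attack_cost k b)%:R + 1 + m1.
have K_gt0 : 0 < K by rewrite ltr_wpDr // ltr_wpDl.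
(* [D = 2] yields both [2 * n <= #|U|] and [B <= 2 * X <= #|U|]; the threshold on [n] only makes [n]
   positive. *)
exists (m0 / (8 * K)), 2; split; first by rewrite divr_gt0 // mulr_gt0.
split=> //; exists 1%N => // n /= n0 M f eps U /andP[eps0 eps1] fE kMb.
have nR0 : 0 < n%:R :> R by rewrite ltr0n.
have M0 : (0 < M)%N.
  case/andP: kMb => + _; rewrite leNgt lt0n; apply: contraNneq => ->.
  by rewrite muln0 mul0n mulr_gt0.
move=> leU; set X := b%:R / eps ^+ b in leU *.
have X_ge1 : 1 <= X.
  rewrite ler_pdivlMr ?exprn_gt0 // mul1r (@le_trans _ _ 1) ?ler1n //.
  by rewrite exprn_ile1 // ltW.
have [B lenB] := attack_length X_ge1; have /andP[le_B ge_B] := lenB.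
have nU : (2 * n <= #|U|)%N by rewrite -(ler_nat R) natrM; lra.
have BU : (B <= #|U|)%N by rewrite -(ler_nat R); lra.
have U0 : (0 < #|U|)%N by apply: leq_trans nU; rewrite muln_gt0.
exists (attacker U B); split=> [a|F succ].
  by rewrite min_queries_attack max_queries_attack size_tuple mul1r.
apply: win_probability_ge => // x w C initC.
have [beta popular] := popular_table k0 (insert_valid initC).
have occM : (#|[pred m | occupant C beta m]| <= M)%N.
  by rewrite -[leqRHS](card_ord M) max_card.
have fpE : 2 ^+ f = n%:R / (M%:R * eps).
  by apply: pow2_log2 => //; rewrite divr_gt0 // mulr_gt0 ?ltr0n.
have := hit_rate_bounds n0 k0 M0 b0 l0 u0 eps0 fpE kMb lenB occM popular.
have -> : #|[pred m | occupant C beta m]|%:R / M%:R / (2 ^+ f) ^+ b =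
    target_probability R (clone_target F x C beta).
  congr (_%:R / _ / _); apply: eq_card => m.
  by rewrite !inE /clone_target; case: occupant.
case/andP=> rate_ge rate_le.
have := @expectation_fresh_value_ge R U n k M b f F b1 x C beta B K.
move=> /= le_value; apply: le_trans (le_value _ U0 nU BU).
  by rewrite ler_pM2r ?invr_gt0 ?mulr_gt0.
by rewrite lerD2l.
Qed.
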